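(* For every even positive integer $n$ there exists a bijection $\psi\colon\{0,1\}^n\to\mathcal{B}_n$, where $\mathcal{B}_n=\{x\in\{0,1\}^{n+1}: |x|>n/2\}$, such that \[ \mathrm{maxStretch}(\psi)\le 4\qquad\text{and}\qquad \mathrm{maxStretch}(\psi^{-1})\le 5 . \]
   Context: For a binary string $x$, $|x|$ denotes its Hamming weight (number of ones), and $\mathrm{distance}(\cdot,\cdot)$ denotes the Hamming distance. Two strings are adjacent if their Hamming distance is $1$; $x+e_i$ denotes $x$ with its $i$-th bit flipped. For $f\colon\{0,1\}^n\to\mathcal{B}_n$, \[\mathrm{maxStretch}(f)=\max_{x\in\{0,1\}^n,\ i\in[n]}\mathrm{distance}(f(x),f(x+e_i)).\] For $g\colon\mathcal{B}_n\to\{0,1\}^n$, $\mathrm{maxStretch}(g)$ is the maximum of $\mathrm{distance}(g(z),g(z'))$ over all pairs $z,z'\in\mathcal{B}_n$ with $\mathrm{distance}(z,z')=1$. *)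

(* Defs.v *)
From mathcomp Require Import all_boot.

Set Implicit Arguments.
Unset Strict Implicit.
Unset Printing Implicit Defensive.

Definition weight n (x : n.-tuple bool) : nat := #|[set i | tnth x i]|.

Definition distance n (x y : n.-tuple bool) : nat :=
  #|[set i | tnth x i != tnth y i]|.

Definition flip n (x : n.-tuple bool) (i : 'I_n) : n.-tuple bool :=
  [tuple (if j == i then ~~ tnth x j else tnth x j) | j < n].

(* The strict inequality makes the rounding in n./2 harmless for odd n. *)
Definition half_ball (n : nat) : Type :=
  {x : n.+1.-tuple bool | n./2 < weight x}.

Definition maxStretch n (f : n.-tuple bool -> half_ball n) : nat :=
  \max_(x : n.-tuple bool) \max_(i < n)
    distance (val (f x)) (val (f (flip x i))).

Definition maxStretch_ball n (g : half_ball n -> n.-tuple bool) : nat :=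
  \max_(z : half_ball n)
    \max_(z' : half_ball n | distance (val z) (val z') == 1)
      distance (g z) (g z').

(* Main.v *)
(** Read a bit string as brackets, [true] opening and [false] closing.  Along a
    chain of the de Bruijn-Tengbergen-Kruyswijk symmetric chain decomposition
    the matched brackets are fixed, and the unmatched ones read 0..01..1.  A
    string with [a] unmatched zeros is sent to the string of its chain which
    keeps only the first [a./2] of them, together with one extra bit recording
    the parity of [a]; this maps a chain onto the copies [0c], [1c] of its
    elements [c] above the middle level and the copy [1c] of its middle element.
    Keeping the first [d] unmatched zeros amounts to a left-to-right bracket
    counter started at [d], and the inverse map is a right-to-left counter.
    The Hamming distance between two runs of such a counter is an explicit
    piecewise linear function of the two initial values and the number of
    unmatched brackets, so that all the bounds reduce to linear arithmetic. *)

Require Import Defs.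
From mathcomp Require Import all_boot.
From mathcomp Require Import zify.

Set Implicit Arguments.
Unset Strict Implicit.
Unset Printing Implicit Defensive.

Fixpoint hamming (s t : seq bool) : nat :=
  if (s, t) is (a :: s', b :: t') then (a != b) + hamming s' t' else 0.

Lemma hammingC s t : hamming s t = hamming t s.
Proof. by elim: s t => [|a s IHs] [|b t] //=; rewrite IHs eq_sym. Qed.

Lemma hamming_cat s1 s2 t1 t2 : size s1 = size t1 ->
  hamming (s1 ++ s2) (t1 ++ t2) = hamming s1 t1 + hamming s2 t2.
Proof.
elim: s1 t1 => [|a s1 IHs] [|b t1] //= [eq_sz].
by rewrite IHs // addnA.
Qed.

Lemma hamming_eq0 s t : size s = size t -> hamming s t = 0 -> s = t.
Proof.
elim: s t => [|a s IHs] [|b t] //= [eq_sz].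
by case: eqP => //= <- /(IHs _ eq_sz) ->.
Qed.

Lemma hamming_eq1 s t : size s = size t -> hamming s t = 1 ->
  exists u b v, s = u ++ b :: v /\ t = u ++ ~~ b :: v.
Proof.
elim: s t => [|a s IHs] [|b t] //= [eq_sz].
case: (eqVneq a b) => [<- /(IHs _ eq_sz) [u [c [v [-> ->]]]]|ab].
  by exists (a :: u), c, v.
rewrite add1n => -[/(hamming_eq0 eq_sz) <-].
by exists [::], a, s; split=> //; case: a b ab => [] [].
Qed.

Lemma distance_hamming n (x y : n.-tuple bool) : distance x y = hamming x y.
Proof.
rewrite /distance -sum1dep_card big_mkcond /=.
elim: n x y => [|n IHn] x y; first by rewrite big_ord0 !tuple0.
case/tupleP: x => a x; case/tupleP: y => b y /=.
rewrite big_ord_recl !tnth0 -IHn; congr (_ + _).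
by apply: eq_bigr => i _; rewrite !tnthS.
Qed.

Lemma weight_count n (x : n.-tuple bool) : weight x = count id x.
Proof.
rewrite /weight -sum1dep_card -sum1_count [RHS]big_tuple.
by apply: eq_bigl.
Qed.

Lemma distance_flip n (x : n.-tuple bool) i : distance x (flip x i) = 1.
Proof.
rewrite /distance -(cards1 i); apply: eq_card => j.
by rewrite !inE tnth_mktuple; case: (j == i); case: (tnth x j).
Qed.

(* A bracket counter never goes below [0]: it uses truncated predecessors. *)
Fixpoint fwd_end (d : nat) (s : seq bool) : nat :=
  if s is b :: s' then fwd_end (if b then d.+1 else d.-1) s' else d.

Fixpoint bwd_end (d : nat) (s : seq bool) : nat :=
  if s is b :: s' then (if b then (bwd_end d s').-1 else (bwd_end d s').+1)
  else d.

Definition unmatched0 := bwd_end 0.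
Definition unmatched1 := fwd_end 0.

Fixpoint fill (d : nat) (s : seq bool) : seq bool :=
  if s is b :: s' then (b || (d == 0)) :: fill (if b then d.+1 else d.-1) s'
  else [::].

(** Mirror image of [fill]: the last [d] unmatched ones survive. *)
Fixpoint clear (d : nat) (s : seq bool) : seq bool :=
  if s is b :: s' then (b && (0 < bwd_end d s')) :: clear d s' else [::].

Lemma unmatched0_cons b s :
  unmatched0 (b :: s) = if b then (unmatched0 s).-1 else (unmatched0 s).+1.
Proof. by []. Qed.

(** The initial [d] acts as [d] opening brackets put before [s], which its unmatched zeros
    consume. *)
Lemma fwd_endE d s : fwd_end d s = d - unmatched0 s + unmatched1 s.
Proof.
rewrite /unmatched1; elim: s d => [|[] s IHs] d /=.
- by rewrite addn0 subn0.
- by rewrite (IHs d.+1) (IHs 1) unmatched0_cons; lia.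
- by rewrite IHs unmatched0_cons; lia.
Qed.

Lemma unmatched1_cons b s :
  unmatched1 (b :: s) = b * (1 - unmatched0 s) + unmatched1 s.
Proof. by case: b; rewrite {1}/unmatched1 /= ?fwd_endE ?mul1n. Qed.

Lemma bwd_endE d s : bwd_end d s = d - unmatched1 s + unmatched0 s.
Proof.
elim: s => [|b s IHs] /=; first by rewrite subn0 addn0.
by rewrite IHs unmatched1_cons unmatched0_cons; case: b; lia.
Qed.

Lemma bwd_end_cat d s t : bwd_end d (s ++ t) = bwd_end (bwd_end d t) s.
Proof. by elim: s => //= b s ->. Qed.

Lemma unmatched0_cat s t :
  unmatched0 (s ++ t) = unmatched0 t - unmatched1 s + unmatched0 s.
Proof. by rewrite /unmatched0 bwd_end_cat bwd_endE. Qed.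

Lemma unmatched_count s :
  unmatched1 s + size s = (count id s).*2 + unmatched0 s.
Proof.
elim: s => // b s; rewrite unmatched1_cons unmatched0_cons /=.
by case: b; lia.
Qed.

Lemma size_fill d s : size (fill d s) = size s.
Proof. by elim: s d => //= b s IHs d; rewrite IHs. Qed.

Lemma size_clear d s : size (clear d s) = size s.
Proof. by elim: s => //= b s ->. Qed.

Lemma fill_cat d s t : fill d (s ++ t) = fill d s ++ fill (fwd_end d s) t.
Proof. by elim: s d => //= b s IHs d; rewrite IHs. Qed.

Lemma clear_cat d s t : clear d (s ++ t) = clear (bwd_end d t) s ++ clear d t.
Proof. by elim: s => //= b s ->; rewrite bwd_end_cat. Qed.

Lemma count_fill d s : count id (fill d s) = count id s + (unmatched0 s - d).
Proof.
elim: s d => //= b s IHs d; rewrite IHs unmatched0_cons.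
by case: b; case: d => [|d] /=; lia.
Qed.

Lemma unmatched0_clear d s :
  unmatched0 (clear d s) = unmatched0 s + (unmatched1 s - d).
Proof.
elim: s => //= b s IHs.
rewrite !unmatched0_cons unmatched1_cons bwd_endE IHs.
by case: b => /=; [case: ltnP => /=|]; lia.
Qed.

(** The outputs differ exactly at the unmatched zeros kept by only one run; the two truncated
    differences add up to an absolute value. *)
Lemma hamming_fill d e s : hamming (fill d s) (fill e s) =
  ((unmatched0 s - d) - (unmatched0 s - e)) +
  ((unmatched0 s - e) - (unmatched0 s - d)).
Proof.
elim: s d e => //= b s IHs d e; rewrite IHs unmatched0_cons.
by case: b; case: d => [|d]; case: e => [|e] /=; lia.
Qed.

Lemma hamming_clear d e s : hamming (clear d s) (clear e s) =
  ((unmatched1 s - d) - (unmatched1 s - e)) +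
  ((unmatched1 s - e) - (unmatched1 s - d)).
Proof.
elim: s => //= b s IHs; rewrite IHs unmatched1_cons !bwd_endE.
by case: b => /=; [do 2!case: ltnP => /=|]; lia.
Qed.

(** The disjunction is what survives induction: past an unmatched one, [e] may exceed the count for
    the tail, but then the tail has no unmatched zeros. *)
Lemma bwd_end_fill d e s :
    unmatched1 s <= e -> (e == unmatched1 s) || (unmatched0 s <= d) ->
  bwd_end e (fill d s) = e - unmatched1 s + minn (unmatched0 s) d.
Proof.
elim: s d => [|b s IHs] d /=; first by rewrite subn0 min0n addn0.
rewrite unmatched1_cons unmatched0_cons.
by case: b; case: d => [|d] /= le_e h; rewrite IHs; lia.
Qed.

(** The filled zeros precede the original unmatched ones, so an exact [e] clears precisely them;
    otherwise nothing was filled. *)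
Lemma fillK d e s :
    unmatched1 s <= e -> (e == unmatched1 s) || (unmatched0 s <= d) ->
  clear e (fill d s) = s.
Proof.
elim: s d => [|b s IHs] d //=; rewrite unmatched1_cons unmatched0_cons.
by case: b; case: d => [|d] /= le_e h;
  rewrite IHs ?bwd_end_fill //; try lia; congr (_ :: _); lia.
Qed.

Lemma clearK d e s :
    unmatched0 s <= d -> (d == unmatched0 s) || (unmatched1 s <= e) ->
  fill d (clear e s) = s.
Proof.
elim: s d => [|b s IHs] d //=.
rewrite bwd_endE unmatched1_cons unmatched0_cons.
by case: b => /= le_d h; [case: ltnP => /= h'|];
  rewrite IHs; try lia; congr (_ :: _); lia.
Qed.

Definition to_ball (s : seq bool) : seq bool :=
  ~~ odd (unmatched0 s) :: fill (unmatched0 s)./2 s.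

(** On [to_ball s] the argument of [clear] equals [unmatched1 s], by [unmatched_count]. *)
Definition of_ball (s : seq bool) : seq bool :=
  if s is b :: t then clear ((count id t).*2 + b - (size t).+1) t else [::].

Lemma to_ballK s : of_ball (to_ball s) = s.
Proof.
have := unmatched_count s.
by rewrite /= count_fill size_fill => h; apply: fillK; lia.
Qed.

Lemma of_ballK (b : bool) s : size s < (count id s).*2 + b ->
  ~~ odd (size s) -> to_ball (of_ball (b :: s)) = b :: s.
Proof.
move=> h ev; have e := unmatched_count s.
rewrite /to_ball /= unmatched0_clear.
(* Halving this number restores the counter of [fill], and its parity restores the leading bit. *)
have -> : unmatched0 s + (unmatched1 s - ((count id s).*2 + b - (size s).+1))
          = (unmatched0 s).*2 + ~~ b by case: b h; lia.
rewrite addnC half_bit_double clearK; try lia.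
by congr (_ :: _); case: b {h}; lia.
Qed.

Lemma weight_to_ball s : (size s)./2 < count id (to_ball s).
Proof.
have := unmatched_count s.
by rewrite /= count_fill; case: (boolP (odd _)) => /=; lia.
Qed.

Lemma hamming_to_ball s t :
  size s = size t -> hamming s t = 1 -> hamming (to_ball s) (to_ball t) <= 4.
Proof.
move=> eq_sz /(hamming_eq1 eq_sz) [u [b [v [-> ->]]]].
wlog -> : b / b = false.
  by case: b => IH; [rewrite hammingC; apply: (IH false)|apply: IH].
rewrite /to_ball /= !fill_cat hamming_cat ?size_fill //= !hamming_fill.
rewrite !unmatched0_cat !fwd_endE !unmatched0_cons.
move: (unmatched0 u) (unmatched1 u) (unmatched0 v) => p q r.
(* The flip changes the number of unmatched zeros by 0, 2 and 1 respectively, so the parity bit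
   changes only in the last case. *)
case: (ltngtP r q) => [r_lt_q|q_lt_r|->].
- have -> : r.+1 - q = 0 by lia.
  have -> : r.-1 - q = 0 by lia.
  by rewrite add0n eqxx; lia.
- have -> : r.+1 - q = (r.-1 - q).+2 by lia.
  rewrite !addSn /= negbK eqxx add0n.
  move: (odd_double_half (r.-1 - q + p)).
  by move: (_./2) (odd _) => h [] /=; lia.
- have -> : q.-1 - q = 0 by lia.
  rewrite subSnn add0n add1n /= uphalf_half negbK.
  move: (odd_double_half p).
  by move: (_./2) (odd _) => h [] /=; lia.
Qed.

Lemma hamming_of_ball s t :
  size s = size t -> hamming s t = 1 -> hamming (of_ball s) (of_ball t) <= 5.
Proof.
move=> eq_sz /(hamming_eq1 eq_sz) [u [b [v [-> ->]]]].
wlog -> : b / b = false.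
  by case: b => IH; [rewrite hammingC; apply: (IH false)|apply: IH].
case: u => [|c u] /=; first by rewrite hamming_clear; lia.
(* The argument of [clear] shifts by at most 2. This costs at most 2 in [v], 1 at the flipped bit
   and 2 in [u]. *)
rewrite !clear_cat hamming_cat ?size_clear //= !hamming_clear.
rewrite !count_cat !size_cat /= !bwd_endE.
move: (unmatched1 u) (unmatched0 v) (unmatched1 v) => p q r.
case: c; lia.
Qed.

Theorem theorem1 (n : nat) (n_gt0 : 0 < n) (n_even : ~~ odd n) :
  exists (psi : n.-tuple bool -> half_ball n)
         (psi_inv : half_ball n -> n.-tuple bool),
    [/\ cancel psi psi_inv, cancel psi_inv psi,
        maxStretch psi <= 4 & maxStretch_ball psi_inv <= 5].
Proof.
have sz_to (x : n.-tuple bool) : size (to_ball x) == n.+1.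
  by rewrite /= size_fill size_tuple.
have wt_to x : n./2 < weight (Tuple (sz_to x)).
  by rewrite weight_count -{1}(size_tuple x) weight_to_ball.
have sz_of (z : half_ball n) : size (of_ball (val z)) == n.
  by case: z => z /=; case/tupleP: z => b t _; rewrite /= size_clear size_tuple.
exists (fun x => Sub (Tuple (sz_to x)) (wt_to x)), (fun z => Tuple (sz_of z)).
split.
- by move=> x; apply: val_inj; apply: to_ballK.
- move=> z; do 2!apply: val_inj => /=.
  case: z => z; case/tupleP: z => b t /= wt.
  rewrite weight_count /= in wt.
  (* As [n] is even, twice the weight is at least [n + 2], so more than [n] remains when the leading
     bit is counted only once. *)
  by apply: of_ballK; rewrite size_tuple //; lia.
- apply/bigmax_leqP => x _; apply/bigmax_leqP => i _.
  rewrite distance_hamming; apply: hamming_to_ball; rewrite ?size_tuple //.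
  by rewrite -distance_hamming distance_flip.
- apply/bigmax_leqP => z _; apply/bigmax_leqP => z' /eqP zz'.
  rewrite distance_hamming; apply: hamming_of_ball; rewrite ?size_tuple //.
  by rewrite -distance_hamming.
Qed.
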